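(* Let $p$ be an odd prime and let $G$ be a group with $|G|=p^5$ and nilpotency class $cl(G)=3$. Then $\mathrm{Aut}_z(G)=Z(\mathrm{Inn}(G))$ if and only if $G$ is isomorphic to the group $$\Phi_8(32)=\langle \alpha_1,\alpha_2,\beta \mid [\alpha_1,\alpha_2]=\beta=\alpha_1^p,\ \beta^{p^2}=\alpha_2^{p^2}=1\rangle .$$
   Context: For a group $G$: $Z(G)$ is the center of $G$; $\mathrm{Inn}(G)$ is the group of inner automorphisms of $G$ and $Z(\mathrm{Inn}(G))$ is its center; $cl(G)$ is the nilpotency class of $G$. An automorphism $\alpha$ of $G$ is central if $x^{-1}\alpha(x)\in Z(G)$ for all $x\in G$ (equivalently, $\alpha$ commutes with every inner automorphism of $G$). $\mathrm{Aut}_z(G)$ denotes the subgroup of $\mathrm{Aut}(G)$ consisting of all central automorphisms. Commutators are $[x,y]=x^{-1}y^{-1}xy$. The name $\Phi_8(32)$ is the one used in R. James's classification of groups of order $p^n$ ($n\le 6$, $p$ odd). *)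

(* Defs.v *)
From mathcomp Require Import all_boot all_fingroup all_solvable.

Set Implicit Arguments.
Unset Strict Implicit.
Unset Printing Implicit Defensive.

Local Open Scope group_scope.

Section AutSubgroups.

Variables (gT : finGroupType) (G : {group gT}).

Definition Inn : {set {perm gT}} := conj_aut G @* G.
Canonical Inn_group := Eval hnf in [group of Inn].

Definition Autz : {set {perm gT}} :=
  [set a in Aut G | [forall x in G, x^-1 * a x \in 'Z(G)]].

Fact Autz_group_set : group_set Autz.
Proof.
apply/group_setP; split=> [|a b].
  apply/setIdP; split; first exact: group1.
  by apply/forall_inP=> x _; rewrite perm1 mulVg group1.
case/setIdP=> AutGa /forall_inP Za /setIdP[AutGb /forall_inP Zb].
apply/setIdP; split; first exact: groupM.
apply/forall_inP=> x Gx; rewrite permM.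
have Gax: a x \in G by rewrite (Aut_closed AutGa).
by rewrite -(mulKVg (a x) (b (a x))) mulgA groupM ?Za ?Zb.
Qed.
Canonical Autz_group := Group Autz_group_set.

End AutSubgroups.

(* Main.v *)
(** Write Z for the center of G and Z_2 for the second center.  If every
    central automorphism is inner, then for each maximal subgroup M containing
    Z the central automorphism x |-> x * f x, with f : G -> G / M -> Z, is
    conjugation by some g in Z_2 with 'C_G[g] = M.  Since G / Z is not cyclic,
    there is more than one such M, which forces #|Z| = p, #|Z_2| = p ^ 3 and
    Z_2 = 'Phi(G), abelian.  Choosing a outside Z_2 centralising G^`(1) and b
    not centralising it, d := [~ a, b] satisfies d ^+ p != 1 (otherwise G would
    be too small), so that <[a]> has order p ^ 3, contains
    G^`(1) = <[a ^+ p]>, and the class a ^: G is the whole coset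
    a *: <[a ^+ p]>.  Hence some b conjugates a to a ^+ (1 + p), and multiplying
    b by a power of a makes b ^+ (p ^ 2) trivial.

    Conversely, in Phi_8(32), with x = alpha_1 and y = alpha_2, the center is
    generated by w = x ^+ (p ^ 2), and the conjugations by powers of y ^+ p and
    x ^+ p already multiply x and y by arbitrary powers of w. *)

Require Import Defs.
From mathcomp Require Import all_boot all_fingroup all_solvable.
From mathcomp Require Import ssralg finalg zmodp zify.

Local Open Scope group_scope.

(** * Powers of 1 + p *)

Section Arith.
Local Open Scope nat_scope.

(** Past the linear term, the binomial expansion is divisible by [p ^ (k + 2)]: the quadratic term
    because an odd [p] divides ['C(p, 2)], the rest because [3 * k >= k + 2]. *)
Lemma expn_1mod (p k u : nat) : odd p -> 0 < k ->
  exists v, (1 + p ^ k * (1 + p * u)) ^ p = 1 + p ^ k.+1 * (1 + p * v).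
Proof.
move=> odd_p k_gt0; have p_gt0: 0 < p by case: p odd_p.
set y := p ^ k * (1 + p * u).
have bin_y n: exists w, (1 + y) ^ n = 1 + n * y + 'C(n, 2) * y ^ 2 + w * y ^ 3.
  elim: n => [|n [w IHn]]; first by exists 0; rewrite bin0n.
  exists ('C(n, 2) + w * (1 + y)).
  rewrite expnSr IHn binS bin1 (expnSr y 2).
  move: (y ^ 2) (expnSr y 1) => y2; rewrite expn1 => ->. lia.
have [w ->] := bin_y p.
have [j def_bin]: exists j, 'C(p, 2) = j * p.
  by exists p.-1./2; rewrite bin2odd // mulnC.
have [m def_k]: exists m, k = m.+1 by exists k.-1; rewrite prednK.
(* The three summands come from the linear, quadratic and cubic terms, after removing [1 + p ^ k.+1]
   and dividing by [p ^ k.+2]. *)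
exists (u + p ^ m * (1 + p * u) ^ 2 * j + w * (p ^ (m + m)) * (1 + p * u) ^ 3).
rewrite def_bin /y def_k !expnMn !expnS !expnD expn0 !muln1.
lia.
Qed.

Lemma expn_succ_prime (p n : nat) : odd p ->
  exists v, (1 + p) ^ (p ^ n) = 1 + p ^ n.+1 * (1 + p * v).
Proof.
move=> odd_p; elim: n => [|n [v IHn]]; first by exists 0; rewrite muln0 !muln1.
by rewrite expnSr expnM IHn; apply: expn_1mod.
Qed.

(** Multiplied by [p], the geometric sum becomes [(1 + p) ^ (p ^ n) - 1]. *)
Lemma sum_expn_succ_prime (p n : nat) : odd p ->
  exists v, \sum_(i < p ^ n) (1 + p) ^ i = p ^ n * (1 + p * v).
Proof.
move=> odd_p; have p_gt0: 0 < p by case: p odd_p.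
have [v def_v] := expn_succ_prime p n odd_p; exists v.
apply/eqP; rewrite -(eqn_pmul2l p_gt0) mulnA -expnS.
by have := predn_exp (1 + p) (p ^ n); rewrite def_v add1n /= => <-.
Qed.

End Arith.

(** * The presentation of Phi_8(32) *)

Section Presentation.
Variable p : nat.

(** Eliminating [b] as [a1 ^+ p] turns the commutator relation into an action of [y] on [<[x]>],
    that is, into metacyclic form. *)
Lemma homGrp_Phi8P (rT : finGroupType) (H : {group rT}) :
  reflect (exists x y : rT,
             [/\ <[x]> <*> <[y]> = H, x ^+ (p ^ 3) = 1, y ^+ (p ^ 2) = 1
               & x ^ y = x ^+ (1 + p)])
          (H \homg Grp (a1 : a2 : b :
             [~ a1, a2] = b = a1 ^+ p,
             b ^+ (p ^ 2)%N = a2 ^+ (p ^ 2)%N = 1)).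
Proof.
apply: (iffP existsP) => [[[[x y] z]] | [x [y [defH xp3 yp2 xy]]]].
  case/eqP=> /= <- xyz zxp zp2 yp2; have xy: x ^ y = x ^+ (1 + p).
    by rewrite conjg_mulR xyz -expgS.
  exists x, y; split=> //; last by rewrite expnS expgM -zxp.
  by apply/esym/joing_idPl; rewrite cycle_subG zxp groupX // mem_gen // inE cycle_id.
exists (x, y, x ^+ p); rewrite /= !xpair_eqE /= -expgM -expnS xp3 yp2 commgEl xy.
rewrite expgS mulKg !eqxx !andbT; apply/eqP; rewrite -defH; apply/joing_idPl.
by rewrite cycle_subG groupX // mem_gen // inE cycle_id.
Qed.

(** The relations present a semidirect product of cyclic groups of orders [p ^ 3] and [p ^ 2]; [G]
    is an image of it of the same order. *)
Lemma isoGrp_Phi8 (gT : finGroupType) (G : {group gT}) :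
  prime p -> odd p -> #|G| = (p ^ 5)%N ->
  (exists x y : gT,
     [/\ <[x]> <*> <[y]> = G, x ^+ (p ^ 3) = 1, y ^+ (p ^ 2) = 1
       & x ^ y = x ^+ (1 + p)]) ->
  G \isog Grp (a1 : a2 : b :
     [~ a1, a2] = b = a1 ^+ p,
     b ^+ (p ^ 2)%N = a2 ^+ (p ^ 2)%N = 1).
Proof.
move=> pr_p odd_p oG Grels.
have p_gt1 := prime_gt1 pr_p.
have q_gt1: 1 < p ^ 3 by rewrite -(exp1n 3) ltn_exp2r.
have r_gt1: 1 < p ^ 2 by rewrite -(exp1n 2) ltn_exp2r.
have rel_iff (rT : finGroupType) (H : {group rT}) :
    (H \homg Grp (x : y : x ^+ (p ^ 3), y ^+ (p ^ 2), x ^ y = x ^+ (1 + p))) =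
    (H \homg Grp (a1 : a2 : b : [~ a1, a2] = b = a1 ^+ p,
                      b ^+ (p ^ 2)%N = a2 ^+ (p ^ 2)%N = 1)).
  apply/existsP/homGrp_Phi8P => [[[x y] /= /eqP[<- xp yp xy]] | [x [y [<- xp yp xy]]]].
    by exists x, y.
  by exists (x, y); rewrite /= xp yp xy !xpair_eqE !eqxx.
have isoX: [set: Extremal.gtype (p ^ 3) (p ^ 2) (1 + p)] \isog
    Grp (x : y : x ^+ (p ^ 3), y ^+ (p ^ 2), x ^ y = x ^+ (1 + p)).
  apply: Extremal.Grp => //; set b : 'Z_(p ^ 3) := Zp1.
  have ob: #[b] = (p ^ 3)%N by rewrite order_Zp1 Zp_cast.
  have q0 : ((p ^ 3)%:R = 0 :> 'Z_#[b])%R by rewrite ob pchar_Zp.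
  have unit_p1: ((1 + p)%:R : 'Z_#[b])%R \is a GRing.unit.
    by rewrite unitZpE ob // coprimeXl // add1n coprimenS.
  (* The acting automorphism is multiplication by the unit [1 + p] modulo [p ^ 3]; its order divides
     [p ^ 2] by [expn_succ_prime]. *)
  exists (Zp_unitm (FinRing.unit 'Z_#[b] unit_p1)).
  rewrite Aut_aut order_injm ?injm_Zp_unitm ?in_setT //; split=> //.
    rewrite order_dvdn -val_eqE FinRing.val_unitX /= -GRing.natrX.
    have [v ->] := expn_succ_prime p 2 odd_p; rewrite GRing.natrD GRing.natrM.
    by rewrite q0 GRing.mul0r GRing.addr0.
  apply/eqP; rewrite autE ?cycle_id //= eq_expg_mod_order val_Zp_nat ?ob //.
  by rewrite modn_mod.
move=> rT H; rewrite -rel_iff; apply: (isoGrp_trans _ isoX).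
apply/(isoGrpP _ isoX); split; first by rewrite Extremal.card // oG -expnD.
by rewrite rel_iff; apply/homGrp_Phi8P.
Qed.
End Presentation.

(** * Central automorphisms *)

Section AutzInn.
Variables (gT : finGroupType) (G : {group gT}).

Lemma InnP a : reflect (exists2 g, g \in G & a = conj_aut G g) (a \in Inn G).
Proof.
apply: (iffP morphimP) => [[g _ Gg ->] | [g Gg ->]]; exists g => //.
exact: (subsetP (normG G)).
Qed.

(** Central automorphisms commute with all conjugations, and a conjugation commuting with all others
    is central, so only the inclusion in [Inn G] is at stake. *)
Lemma Autz_sub_InnP : reflect (Autz G = 'Z(Inn G)) (Autz G \subset Inn G).
Proof.
have nGG := subsetP (normG G).
have AutJ g: g \in G -> conj_aut G g \in Aut G.
  by move=> Gg; apply: (subsetP (Aut_conj_aut G G)); rewrite mem_morphim ?nGG.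
apply: (iffP idP) => [sAI | ->]; last exact: center_sub.
apply/eqP; rewrite eqEsubset subsetI sAI /=; apply/andP; split.
  apply/centsP=> a Aa _ /InnP[g Gg ->].
  have /setIdP[AutGa /forall_inP Za] := Aa.
  apply: (eq_Aut (A := G)); rewrite ?groupM ?AutJ // => x Gx.
  have Gax y: y \in G -> a y \in G by apply: Aut_closed.
  rewrite !permM !conj_autE ?Gax //.
  have -> : a (x ^ g) = a x ^ a g by rewrite -!(autmE AutGa) morphJ.
  have /centerP[_ cz] := Za _ Gg.
  (* [a g] and [g] differ by a central factor, so they conjugate alike. *)
  rewrite -[a g](mulKVg g) conjgM [RHS]conjgE.
  by rewrite -cz ?groupJ ?Gax // mulKg.
apply/subsetP=> a /centerP[/InnP[g Gg ->] cIg]; rewrite inE AutJ //=.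
apply/forall_inP=> x Gx; rewrite conj_autE // -commgEl.
apply/centerP; split=> [|y Gy]; first exact: groupR.
have cgx : commute (conj_aut G g) (conj_aut G x) :=
  cIg _ (mem_morphim _ (nGG x Gx) Gx).
have cgxJ u : u \in G -> u ^ (x * g) = u ^ (g * x).
  move=> Gu; rewrite -!(@conj_autE _ G) ?(groupM Gx Gg) ?(groupM Gg Gx) //.
  by rewrite !conj_aut_morphM ?nGG ?cgx.
(* [[~ x, g]] is the quotient of [x * g] by [g * x], which act alike on [G] by conjugation. *)
apply/esym/commgP/conjg_fixP; rewrite -{1}(conjgKV (g * x) y) -!conjgM -mulgA.
by rewrite -commgC conjgM cgxJ ?conjgKV // groupJ // groupV groupM.
Qed.

End AutzInn.

(** * Central automorphisms of Phi_8(32) *)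

Section Phi8.
Variables (gT : finGroupType) (G : {group gT}) (p : nat) (x y : gT).
Hypotheses (pr_p : prime p) (odd_p : odd p) (oG : #|G| = (p ^ 5)%N).
Hypotheses (genG : <[x]> <*> <[y]> = G) (xp3 : x ^+ (p ^ 3) = 1).
Hypotheses (yp2 : y ^+ (p ^ 2) = 1) (xy : x ^ y = x ^+ (1 + p)).

Let Gx : x \in G. Proof. by rewrite -genG mem_gen // inE cycle_id. Qed.
Let Gy : y \in G. Proof. by rewrite -genG mem_gen // inE cycle_id orbT. Qed.

Lemma Phi8_mulg : <[x]> * <[y]> = G.
Proof.
by rewrite -genG norm_joinEr // cycle_subG inE -cycleJ xy cycleX.
Qed.

(** The product of [<[x]>] and [<[y]>] has [p ^ 5] elements, so neither order can fall short of its
    bound. *)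
Lemma Phi8_order : #[x] = (p ^ 3)%N.
Proof.
have p_gt0 := prime_gt0 pr_p.
have ox : #[x] %| p ^ 3 by rewrite order_dvdn xp3.
have oy : #[y] %| p ^ 2 by rewrite order_dvdn yp2.
apply/eqP; rewrite eqn_leq dvdn_leq ?expn_gt0 ?p_gt0 //=.
have le1 : p ^ 3 * p ^ 2 <= #[x] * #[y].
  by rewrite -expnD -oG -Phi8_mulg !orderE mul_cardG leq_pmulr ?cardG_gt0.
rewrite -(leq_pmul2r (_ : 0 < p ^ 2)) ?expn_gt0 ?p_gt0 //.
by apply: leq_trans le1 _; rewrite leq_mul2l dvdn_leq ?expn_gt0 ?p_gt0 ?orbT.
Qed.

Let conj_yX n : x ^ (y ^+ n) = x ^+ ((1 + p) ^ n).
Proof.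
by elim: n => [|n IHn]; rewrite ?conjg1 // expgSr conjgM IHn conjXg xy -expgM expnS.
Qed.

Let w := x ^+ (p ^ 2).

Lemma Phi8_conj_yp : x ^ (y ^+ p) = x * w.
Proof.
have [v] := expn_succ_prime p 1 odd_p; rewrite conj_yX expn1 => ->.
by rewrite mulnDr muln1 mulnA -expnSr expgD expgD expgM xp3 expg1n mulg1.
Qed.

(** Let [x ^+ i * y ^+ j] be central. Commuting with [x] forces [y ^+ j = 1], since otherwise
    [y ^+ p] would centralise [x]; commuting with [y] then gives [x ^+ (i * p) = 1]. *)
Lemma Phi8_center : 'Z(G) \subset <[w]>.
Proof.
have p_gt0 := prime_gt0 pr_p; have p_gt1 := prime_gt1 pr_p.
have w_neq1 : w != 1.
  by rewrite -order_dvdn Phi8_order dvdn_Pexp2l.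
apply/subsetP=> z /centerP[]; rewrite -{1}[gval G]Phi8_mulg.
case/mulsgP=> [_ _ /cycleP[i ->] /cycleP[j ->] ->] cz.
have cxyj : commute x (y ^+ j).
  have := cz x Gx; rewrite /commute mulgA (commuteX i (commute_refl x)) -!mulgA.
  by move/mulgI/esym.
have yj1 : y ^+ j = 1.
  apply/eqP; apply: contraR w_neq1 => yj_neq1.
  have gcd_p : gcdn j (p ^ 2) %| p.
    have /(dvdn_pfactor _ _ pr_p)[[|[|[|//]]] _ def_g] := dvdn_gcdr j (p ^ 2).
    - by rewrite def_g dvd1n.
    - by rewrite def_g.
    by case/eqP: yj_neq1; have /dvdnP[k ->] := dvdn_gcdl j (p ^ 2);
      rewrite def_g mulnC expgM yp2 expg1n.
  have cxyp : commute x (y ^+ p).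
    have /dvdnP[k ->] := gcd_p; rewrite mulnC expgM; apply: commuteX.
    case: j {yj_neq1 cz gcd_p} cxyj => [|j] cxyj.
      by rewrite gcd0n yp2; apply: commute1.
    (* Bezout makes [y ^+ gcdn j.+1 (p ^ 2)] a power of [y ^+ j.+1]; the exponent 0 is treated apart
       because [egcdnP] needs a positive argument. *)
    have [km kn def_km _] := egcdnP (p ^ 2) (isT : 0 < j.+1).
    have -> : y ^+ gcdn j.+1 (p ^ 2) = (y ^+ j.+1) ^+ km.
      by rewrite -expgM mulnC def_km expgD mulnC expgM yp2 expg1n mul1g.
    exact: commuteX.
  by rewrite -(can_eq (mulKg x)) mulg1 -Phi8_conj_yp; apply/eqP/conjg_fixP/commgP.
rewrite yj1 mulg1 in cz *.
have := cz y Gy; move/commgP/conjg_fixP; rewrite conjXg xy -expgM mulnDl mul1n.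
rewrite expgD => /(canRL (mulKg _)); rewrite mulVg => /eqP.
rewrite -order_dvdn Phi8_order expnS dvdn_pmul2l // => /dvdnP[k ->].
by rewrite mulnC expgM mem_cycle.
Qed.

Lemma Phi8_Autz : Autz G = 'Z(Inn G).
Proof.
have cxw : commute x w by apply: commuteX.
have cyw : commute y w.
  apply/esym/commgP/conjg_fixP; rewrite conjXg xy -expgM mulnC expgM.
  by rewrite expgD -[in X in _ * X]expgM -expnSr xp3 mulg1.
have comm_x_yp : [~ x, y ^+ p] = w by rewrite commgEl Phi8_conj_yp mulKg.
have comm_y_xp : [~ y, x ^- p] = w.
  have comm_xp_y : [~ x ^+ p, y] = w.
    by rewrite commgEl conjXg xy -expgM mulnDl mul1n expgD mulKg.
  rewrite commgV -invg_comm comm_xp_y ?invgK //.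
  by apply/commuteV/commute_sym/commuteX/commute_sym.
apply/Autz_sub_InnP/subsetP=> a /setIdP[AutGa /forall_inP Za].
have /cycleP[i axE] := subsetP Phi8_center _ (Za x Gx).
have /cycleP[j ayE] := subsetP Phi8_center _ (Za y Gy).
(* Conjugation by [y ^+ p] fixes [y] and multiplies [x] by [w]; conjugation by [x ^- p] fixes [x]
   and multiplies [y] by [w]. *)
set g := y ^+ p ^+ i * x ^- p ^+ j.
have Gg : g \in G by rewrite groupM // groupX // ?groupV groupX.
apply/InnP; exists g => //.
have nGG := subsetP (normG G).
have AutJ : conj_aut G g \in Aut G.
  by apply: (subsetP (Aut_conj_aut G G)); rewrite mem_morphim ?nGG.
have xg : a x = x ^ g.
  have xgy : x ^ (y ^+ p ^+ i) = x * w ^+ i.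
    rewrite conjg_mulR commgX comm_x_yp //.
    exact/commute_sym/commuteX/commute_sym.
  rewrite -(mulKVg x (a x)) axE conjgM xgy.
  apply/esym/conjg_fixP/commgP/commuteX/commuteV/commuteX.
  exact/commute_sym/commuteM/commuteX/commute_sym.
have yg : a y = y ^ g.
  rewrite -(mulKVg y (a y)) ayE conjgM.
  have -> : y ^ (y ^+ p ^+ i) = y.
    by apply/conjg_fixP/commgP/commuteX/commuteX.
  rewrite conjg_mulR commgX comm_y_xp //.
  exact/commute_sym/commuteV/commuteX/commute_sym.
apply: (eq_Aut AutGa AutJ) => u; rewrite -Phi8_mulg.
case/mulsgP=> [_ _ /cycleP[k ->] /cycleP[l ->] ->].
have Gkl : x ^+ k * y ^+ l \in G by rewrite groupM ?groupX.
rewrite (conj_autE Gg Gkl) conjMg !conjXg -xg -yg.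
by rewrite -!(autmE AutGa) morphM ?morphX ?groupX.
Qed.

End Phi8.

(** * Groups of order p ^ 5 whose central automorphisms are inner *)

Section CentralAut.
Variables (gT : finGroupType) (G M : {group gT}) (p : nat).

Lemma index_prime_hom (z : gT) : M <| G -> prime p -> #|G : M| = p -> #[z] = p ->
  exists f : {morphism G >-> gT}, f @* G \subset <[z]> /\ 'ker f = M.
Proof.
move=> nsMG pr_p iMG oz; have [sMG nMG] := andP nsMG.
have oGM : #|G / M| = p by rewrite card_quotient.
have [X defGM] : exists X, G / M = <[X]>.
  by apply/cyclicP; rewrite prime_cyclic ?oGM.
have oX : #[X] = p by rewrite orderE -defGM.
have dvd_zX : #[z] %| #[X] by rewrite oX oz.
have GX u : u \in G -> coset M u \in <[X]> by rewrite -defGM; apply: mem_quotient.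
have fM : {in G &, {morph (fun u => eltm dvd_zX (coset M u)) : u v / u * v}}.
  by move=> u v Gu Gv; rewrite /= morphM ?(subsetP nMG) // morphM ?GX.
exists (Morphism fM); split.
  apply/subsetP=> _ /morphimP[u _ Gu ->] /=.
  by rewrite -(im_eltm dvd_zX) mem_morphim ?GX.
have inj : 'injm (eltm dvd_zX) by rewrite injm_eltm oX oz.
apply/setP=> u; apply/morphpreP/idP => [[Gu /set1P /= fu1] | Mu].
  apply: coset_idr; first exact: (subsetP nMG).
  apply/eqP; rewrite -(morph_injm_eq1 inj) ?GX //; exact/eqP.
by rewrite (subsetP sMG) // inE /= coset_id // morph1.
Qed.

Lemma Inn_centraliser_of_index_prime :
    prime p -> M <| G -> #|G : M| = p -> 'Z(G) \subset M -> p %| #|'Z(G)| ->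
    Autz G \subset Inn G ->
  exists g, [/\ g \in G, 'C_G[g] = M & {in G, forall x, [~ x, g] \in 'Z(G)}].
Proof.
move=> pr_p nsMG iMG sZM /(Cauchy pr_p)[z Zz oz] sAI.
have [f [sfz kerf]] := index_prime_hom z nsMG pr_p iMG oz.
have Zf u : u \in G -> f u \in 'Z(G).
  move=> Gu; apply: subsetP (_ : <[z]> \subset 'Z(G)) _ _; first by rewrite cycle_subG.
  by apply: (subsetP sfz); rewrite mem_morphim.
have sZG := subsetP (center_sub G).
have aM : {in G &, {morph (fun u => u * f u) : u v / u * v}}.
  move=> u v Gu Gv /=; rewrite morphM // -!mulgA; congr (_ * _).
  by have /centerP[_ cfu] := Zf u Gu; rewrite [RHS]mulgA (cfu v Gv) mulgA.
pose a := Morphism aM.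
(* If [u * f u = 1] then [u] is central, hence in [M = 'ker f], so [f u = 1] and [u = 1]. *)
have inj_a : 'injm a.
  apply/subsetP=> u /morphpreP[Gu /set1P/= uf1].
  have Zu : u \in 'Z(G).
    rewrite -groupV (_ : u^-1 = f u) ?Zf //.
    by apply/eqP; rewrite eq_invg_mul uf1.
  have : u \in 'ker f by rewrite kerf (subsetP sZM).
  by move/mker=> fu1; rewrite fu1 mulg1 in uf1; rewrite uf1 inE.
have im_a : a @* G = G.
  apply/morphim_fixP=> //; apply/subsetP=> _ /morphimP[u _ Gu ->] /=.
  by rewrite groupM // sZG ?Zf.
have aE u : u \in G -> aut inj_a im_a u = u * f u by apply: autE.
have : aut inj_a im_a \in Autz G.
  rewrite inE Aut_aut; apply/forall_inP=> u Gu.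
  by rewrite aE // mulKg Zf.
case/(subsetP sAI)/InnP=> g Gg def_a.
have fE u : u \in G -> f u = [~ u, g].
  by move=> Gu; rewrite commgEl -(conj_autE Gg Gu) -def_a aE // mulKg.
exists g; split=> // [|u Gu]; last by rewrite -fE ?Zf.
rewrite -kerf; apply/setP=> u; rewrite inE; apply/andP/morphpreP.
  by case=> Gu /cent1P/commgP/eqP; rewrite -fE // => ->; rewrite inE.
by case=> Gu /set1P; rewrite fE // => /eqP/commgP/cent1P.
Qed.
End CentralAut.

(** * Small p-groups and power formulas *)

Lemma cyclic_pgroup_small (gT : finGroupType) (Q : {group gT}) (p : nat) :
  prime p -> p.-group Q -> #|Q| < p ^ 2 -> cyclic Q.
Proof.
move=> pr_p /p_natP[k oQ]; rewrite oQ ltn_exp2l ?prime_gt1 //.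
case: k oQ => [|[|//]] oQ _; last by rewrite prime_cyclic ?oQ.
by rewrite (card1_trivg oQ) cyclic1.
Qed.

Lemma leq_card_mulG (gT : finGroupType) (A B : {group gT}) :
  #|A * B| <= #|A| * #|B|.
Proof. by rewrite mul_cardG leq_pmulr // cardG_gt0. Qed.

Lemma order_pfactor (gT : finGroupType) (x : gT) p n : prime p ->
  x ^+ (p ^ n.+1) = 1 -> x ^+ (p ^ n) != 1 -> #[x] = (p ^ n.+1)%N.
Proof.
move=> pr_p /eqP; rewrite -!order_dvdn => /(dvdn_pfactor _ _ pr_p)[k le_k ->].
rewrite dvdn_Pexp2l ?prime_gt1 // -ltnNge => lt_k.
by congr (_ ^ _)%N; apply/eqP; rewrite eqn_leq le_k.
Qed.

(** Conjugation by [b] sends [a] to [a * d] and [d] to [d * z] and fixes [z], so the exponents obey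
    Pascal's rule. *)
Lemma conjX_class3 (gT : finGroupType) (a b : gT) n :
    let d := [~ a, b] in let z := [~ d, b] in
    commute a d -> commute a z -> commute b z -> commute d z ->
  a ^ (b ^+ n) = a * d ^+ n * z ^+ 'C(n, 2).
Proof.
move=> d z cad caz cbz cdz; elim: n => [|n IHn]; first by rewrite conjg1 !mulg1.
rewrite expgSr conjgM IHn !conjMg !conjXg.
have -> : z ^ b = z by apply/conjg_fixP/commgP/commute_sym.
rewrite (conjg_mulR d) (conjg_mulR a) -/d -/z expgMn // binS bin1 addnC expgD.
by rewrite expgS !mulgA.
Qed.

Lemma expMg_conjX (gT : finGroupType) (b h : gT) q n : h ^ b = h ^+ q ->
  (b * h) ^+ n = b ^+ n * h ^+ (\sum_(i < n) q ^ i).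
Proof.
move=> hb; elim: n => [|n IHn]; first by rewrite big_ord0 mulg1.
rewrite expgSr IHn big_ord_recl expn0 expgSr -!mulgA; congr (_ * _).
rewrite [LHS]mulgA [_ * b]conjgC -mulgA conjXg hb -expgM -expgSr add1n.
congr (_ * _ ^+ _.+1); rewrite big_distrr /=.
by apply: eq_bigr => i _; rewrite expnS.
Qed.

Section Forward.
Variables (gT : finGroupType) (G : {group gT}) (p : nat).
Hypotheses (pr_p : prime p) (odd_p : odd p) (oG : #|G| = (p ^ 5)%N).
Hypothesis clG : nil_class G = 3.
Hypothesis (sAI : Autz G \subset Inn G).

Let p_gt0 := prime_gt0 pr_p.
Let p_gt1 := prime_gt1 pr_p.
Let pG : p.-group G. Proof. by rewrite /pgroup oG pnatX pnat_id. Qed.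
Let nilG := pgroup_nil pG.

(** * The center, the second center and the Frattini subgroup *)

Let nabG : ~~ abelian G. Proof. by rewrite -nil_class1 clG. Qed.

Let ucn2_proper : 'Z_2(G) != G.
Proof. by apply/eqP=> /(ucn_nil_classP 2 nilG); rewrite clG. Qed.

Let der_ucn2 : G^`(1) \subset 'Z_2(G).
Proof.
have /eqP defZ3: 'Z_3(G) == G by apply/eqP/(ucn_nil_classP 3 nilG); rewrite clG.
by rewrite derg1 -{1}defZ3 ucn_comm.
Qed.

Let der_not_center : ~~ (G^`(1) \subset 'Z(G)).
Proof.
apply: contra ucn2_proper => sG'Z; apply/eqP/setP=> x; rewrite ucnSnR ucn1 inE.
apply: andb_idr => Gx; apply: subset_trans sG'Z.
by rewrite derg1 commSg // sub1set.
Qed.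

Let mem_ucn2 g :
  g \in G -> {in G, forall x, [~ x, g] \in 'Z(G)} -> g \in 'Z_2(G).
Proof.
move=> Gg cg; rewrite ucnSnR ucn1 inE Gg /= commGC gen_subG.
by apply/subsetP=> _ /imset2P[x _ Gx /set1P-> ->]; apply: cg.
Qed.

(** [G / 'Z_2(G)] is the central quotient of [G / 'Z(G)], so its being cyclic would make [G / 'Z(G)]
    abelian and the class at most 2. *)
Lemma quotient_ucn2_not_cyclic : ~~ cyclic (G / 'Z_2(G)).
Proof.
apply/negP=> cycG2.
have isoG2 := third_isog (ucn_subS 1 G) (ucn_normal 1 G) (ucn_normal 2 G).
have: abelian (G / 'Z(G)).
  apply: cyclic_center_factor_abelian.
  by rewrite -ucn1 -ucn_central (isog_cyclic isoG2).
by rewrite -nil_class1 nil_class_quotient_center // clG.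
Qed.

Let card_center_ge : p %| #|'Z(G)|.
Proof.
have ntZ: 'Z(G) != 1.
  apply: contra nabG => /eqP/(trivg_center_pgroup pG)->; exact: abelian1.
by have [_ ? _] := pgroup_pdiv (pgroupS (center_sub G) pG) ntZ.
Qed.

Let maximal_cent (M : {group gT}) : maximal M G -> 'Z(G) \subset M ->
  exists2 g, g \in 'Z_2(G) & 'C_G[g] = M.
Proof.
move=> maxM sZM.
have [g [Gg defM cg]] := Inn_centraliser_of_index_prime _ _ _ _ pr_p
  (p_maximal_normal pG maxM) (p_maximal_index pG maxM) sZM card_center_ge sAI.
by exists g; first exact: mem_ucn2.
Qed.

(* If Z had index p in Z_2, then 'C_G(Z_2) would be the only maximal subgroup
   containing Z, making G / Z cyclic. *)
Lemma index_center_ucn2 : #|'Z_2(G) : 'Z(G)| != p.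
Proof.
apply/eqP=> iZ.
have sZZ2: 'Z(G) \subset 'Z_2(G) by rewrite -ucn1 ucn_subS.
have uniqM (M : {group gT}) : maximal M G -> 'Z(G) \subset M -> M :=: 'C_G('Z_2(G)).
  move=> maxM sZM; have [g Z2g defM] := maximal_cent M maxM sZM.
  have ltMG := maxgroupp maxM.
  (* [g] is not central, its centraliser being proper, and ['Z(G)] is maximal in ['Z_2(G)]. *)
  have Z2E : 'Z(G) <*> <[g]> = 'Z_2(G).
    have notZg : g \notin 'Z(G).
      apply/negP=> /centerP[_ cg]; have /properP[_ [u Gu]] := ltMG.
      by rewrite -defM inE Gu => /cent1P[]; apply/esym/cg.
    have nsZ : 'Z(G) <| 'Z_2(G) by apply: normalS sZZ2 (ucn_sub 2 G) (center_normal G).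
    have maxZ : maximal 'Z(G) 'Z_2(G) by rewrite p_index_maximal ?iZ.
    rewrite norm_joinEr ?(mulg_normal_maximal nsZ maxZ) ?cycle_subG //.
    by apply: subsetP Z2g; apply: normal_norm.
  have cZ : 'C_G('Z(G)) = G by apply/setIidPl; rewrite centsC subsetIr.
  by rewrite -Z2E centY cent_cycle setIA cZ defM.
have [M0 maxM0 sZM0]: exists2 M : {group gT}, maximal M G & 'Z(G) \subset M.
  have [defG|//] := maximal_exists (center_sub G).
  by case/negP: nabG; rewrite -defG center_abelian.
have [sM0G [x Gx M0'x]] := properP (maxgroupp maxM0).
(* This subgroup is not [G], as [G / 'Z(G)] is not cyclic, so a second maximal subgroup contains
   ['Z(G)] and [x]. *)
have sZxG: 'Z(G) <*> <[x]> \subset G by rewrite join_subG center_sub cycle_subG.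
have [defG|[M maxM]] := maximal_exists sZxG.
  have nZx : x \in 'N('Z(G)) by rewrite (subsetP (gFnorm _ G)).
  case/negP: nabG; apply: cyclic_center_factor_abelian.
  rewrite -[X in X / _]defG quotientYidl ?cycle_subG //.
  by rewrite quotient_cycle // cycle_cyclic.
rewrite join_subG cycle_subG => /andP[sZM Mx].
by rewrite (uniqM M0) // -(uniqM M) // Mx in M0'x.
Qed.

(** With orders [p ^ a] and [p ^ b]: [0 < a < b], [b != a.+1], and [b <= 3] because [G / 'Z_2(G)] is
    not cyclic. Only [a = 1], [b = 3] remains. *)
Lemma card_center_ucn2 : #|'Z(G)| = p /\ #|'Z_2(G)| = (p ^ 3)%N.
Proof.
have sZZ2: 'Z(G) \subset 'Z_2(G) by rewrite -ucn1 ucn_subS.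
have [a oZ] := p_natP (pgroupS (center_sub G) pG).
have [b oZ2] := p_natP (pgroupS (ucn_sub 2 G) pG).
have a_gt0 : 0 < a.
  by have := card_center_ge; rewrite oZ; case: a {oZ}; rewrite // dvdn1 gtn_eqF.
have b_le3 : b <= 3.
  rewrite leqNgt; apply: contra quotient_ucn2_not_cyclic => b_gt3.
  apply: (cyclic_pgroup_small _ _ _ pr_p (quotient_pgroup _ pG)).
  have := Lagrange (ucn_sub 2 G); rewrite card_quotient ?gFnorm // oG oZ2 => eq5.
  rewrite -(ltn_pmul2l (_ : 0 < p ^ b)) ?expn_gt0 ?p_gt0 // eq5 -expnD.
  by rewrite ltn_exp2l // addn2.
have a_lt_b : a < b.
  have ltZ : 'Z(G) \proper 'Z_2(G).
    rewrite properE sZZ2; apply: contra der_not_center.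
    exact: subset_trans der_ucn2.
  by have := proper_card ltZ; rewrite oZ oZ2 ltn_exp2l.
have b_neq : b != a.+1.
  apply: contra index_center_ucn2 => /eqP def_b; have := Lagrange sZZ2.
  rewrite oZ oZ2 def_b expnSr => /eqP.
  by rewrite eqn_pmul2l ?expn_gt0 ?p_gt0.
have [a1 b3] : a = 1%N /\ b = 3.
  by move: a_gt0 b_le3 a_lt_b b_neq; clear; lia.
by rewrite oZ oZ2 a1 b3.
Qed.

Let oZ : #|'Z(G)| = p. Proof. by case: card_center_ucn2. Qed.
Let oZ2 : #|'Z_2(G)| = (p ^ 3)%N. Proof. by case: card_center_ucn2. Qed.

Let sZG' : 'Z(G) \subset G^`(1).
Proof.
have ntG' : G^`(1) != 1 by apply: contra nabG => /eqP/derG1P.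
have ntGZ := meet_center_nil nilG (der_normal 1 G) ntG'.
have pGZ := pgroupS (subset_trans (subsetIr _ _) (center_sub G)) pG.
apply/setIidPr/eqP; rewrite eqEcard subsetIr /= oZ.
by have [_ /dvdn_leq-> //] := pgroup_pdiv (pGZ _) ntGZ.
Qed.

Lemma der_cent_ucn2 : G^`(1) \subset 'C('Z_2(G)).
Proof.
have cZ2 : [~: 'Z_2(G), G, G] = 1.
  apply/commG1P; apply: subset_trans (ucn_comm 1 G) _.
  by rewrite ucn1 subsetIr.
by apply/commG1P; rewrite derg1 three_subgroup // (commGC G).
Qed.

Lemma ucn2_abelian : abelian 'Z_2(G).
Proof.
have sG'Z : G^`(1) \subset 'Z('Z_2(G)) by rewrite subsetI der_ucn2 der_cent_ucn2.
have ltZ : 'Z(G) \proper 'Z('Z_2(G)).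
  rewrite properE (subset_trans sZG') //; apply: contra der_not_center.
  exact: subset_trans sG'Z.
apply: cyclic_center_factor_abelian.
apply: (cyclic_pgroup_small _ _ _ pr_p
  (quotient_pgroup _ (pgroupS (ucn_sub 2 G) pG))).
rewrite card_quotient ?gFnorm // -(ltn_pmul2l (cardG_gt0 'Z('Z_2(G)))).
rewrite Lagrange ?center_sub // oZ2 (expnS p 2) ltn_pmul2r ?expn_gt0 ?p_gt0 //.
by rewrite -oZ proper_card.
Qed.

Lemma Phi_ucn2 : 'Phi(G) = 'Z_2(G).
Proof.
have sZ2Phi : 'Z_2(G) \subset 'Phi(G).
  apply/bigcapsP=> M /predU1P[-> | maxM]; first exact: ucn_sub.
  have sZM : 'Z(G) \subset M.
    apply: subset_trans sZG' _.
    have [sMG nMG] := andP (p_maximal_normal pG maxM).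
    apply: der1_min => //; apply/cyclic_abelian/prime_cyclic.
    by rewrite card_quotient // (p_maximal_index pG maxM).
  have [g Z2g <-] := maximal_cent M maxM sZM.
  rewrite subsetI ucn_sub -cent_cycle centsC cycle_subG.
  by apply: subsetP Z2g; apply: ucn2_abelian.
apply/eqP; rewrite eq_sym eqEcard sZ2Phi oZ2 leqNgt.
apply: contra nabG => ltPhi; apply/cyclic_abelian/Phi_quotient_cyclic.
apply: (cyclic_pgroup_small _ _ _ pr_p (quotient_pgroup _ pG)).
rewrite card_quotient ?gFnorm // -(ltn_pmul2l (cardG_gt0 'Phi(G))).
rewrite Lagrange ?Phi_sub // oG (expnD p 3 2).
by rewrite ltn_pmul2r ?expn_gt0 ?p_gt0.
Qed.

(** * Generators and the metacyclic relations *)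

Let comm_Z2 u x : u \in 'Z_2(G) -> x \in G -> [~ u, x] \in 'Z(G).
Proof.
by move=> Z2u Gx; rewrite -ucn1; apply: (subsetP (ucn_comm 1 G)); apply: mem_commg.
Qed.

Let Z_exp u : u \in 'Z(G) -> u ^+ p = 1.
Proof. by move=> Zu; apply/eqP; rewrite -order_dvdn -oZ order_dvdG. Qed.

Let Z_comm u x : u \in 'Z(G) -> x \in G -> commute x u.
Proof. by case/centerP=> _ cu Gx; apply/esym/cu. Qed.

(** The class of [u] lies in the coset [u *: 'Z(G)], so it has at most [p] elements. *)
Lemma card_cent1_ucn2 u : u \in 'Z_2(G) -> u \notin 'Z(G) ->
  #|'C_G[u]| = (p ^ 4)%N.
Proof.
move=> Z2u notZu; have Gu := subsetP (ucn_sub 2 G) u Z2u.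
have [k /= oC] := p_natP (pgroupS (subsetIl G 'C[u]) pG).
have k_lt5 : k < 5.
  rewrite -(ltn_exp2l _ _ p_gt1) -oG -oC proper_card // properE subsetIl /=.
  apply: contra notZu; rewrite subsetI subxx /= => sGC.
  by apply/centerP; split=> // x Gx; apply/esym/cent1P/(subsetP sGC).
have clu : #|u ^: G| <= p.
  rewrite -oZ -(card_lcoset _ u); apply/subset_leq_card/subsetP=> _ /imsetP[x Gx ->].
  by rewrite mem_lcoset -commgEl comm_Z2.
have := Lagrange (subsetIl G 'C[u]); rewrite index_cent1 oC oG => eq5.
have k_ge4 : 4 <= k.
  by rewrite -ltnS -(leq_exp2l _ _ p_gt1) -eq5 expnSr leq_mul2l clu orbT.
by congr (_ ^ _)%N; apply/eqP; rewrite eqn_leq k_ge4 andbT.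
Qed.

(** A maximal subgroup containing [a] and [b] would share ['Z_2(G)] and [a] with ['C_G[u]]; both
    having order [p ^ 4], they would coincide, against the choice of [b]. *)
Lemma joing_cycles_cent1 u a b : u \in 'Z_2(G) -> u \notin 'Z(G) ->
    a \in G -> b \in G -> a \notin 'Z_2(G) -> commute a u -> ~ commute b u ->
  <[a]> <*> <[b]> = G.
Proof.
move=> Z2u notZu Ga Gb notZ2a cau ncbu.
have sHG : <[a]> <*> <[b]> \subset G by rewrite join_subG !cycle_subG Ga.
have [// | [M maxM]] := maximal_exists sHG.
rewrite join_subG !cycle_subG => /andP[Ma Mb].
have sZ2M : 'Z_2(G) \subset M by rewrite -Phi_ucn2 Phi_sub_max.
have oM : #|M| = (p ^ 4)%N.
  have := Lagrange (normal_sub (p_maximal_normal pG maxM)).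
  rewrite (p_maximal_index pG maxM) oG (expnSr p 4) => /eqP.
  by rewrite eqn_pmul2r // => /eqP.
have oC := card_cent1_ucn2 u Z2u notZu.
have sZ2C : 'Z_2(G) \subset 'C_G[u].
  by rewrite subsetI ucn_sub -cent_cycle centsC cycle_subG (subsetP ucn2_abelian).
have ltZ2 : 'Z_2(G) \proper M :&: 'C_G[u].
  apply/properP; split; first by rewrite subsetI sZ2M.
  exists a => //; apply/setIP; split=> //.
  by apply/setIP; split=> //; apply/cent1P.
have sMC : M \subset 'C_G[u].
  have [k /= oMC] := p_natP
    (pgroupS (subsetIr M _) (pgroupS (subsetIl G 'C[u]) pG)).
  apply/setIidPl/eqP; rewrite eqEcard subsetIl oM /= oMC leq_exp2l //.
  by have := proper_card ltZ2; rewrite oZ2 oMC ltn_exp2l.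
by case: ncbu; apply/cent1P; have := subsetP sMC b Mb; rewrite inE => /andP[].
Qed.

Lemma exists_generators : exists a b,
  [/\ a \in G, b \in G & <[a]> <*> <[b]> = G] /\
  [/\ a \notin 'Z_2(G), commute a [~ a, b], [~ a, b] \notin 'Z(G)
     & G^`(1) \subset 'Z(G) * <[[~ a, b]]>].
Proof.
have /subsetPn[c G'c notZc] := der_not_center.
have Z2c := subsetP der_ucn2 c G'c; have oC := card_cent1_ucn2 c Z2c notZc.
have /subsetPn[a /setIP[Ga /cent1P cac] notZ2a] : ~~ ('C_G[c] \subset 'Z_2(G)).
  by apply/negP=> /subset_leq_card; rewrite oC oZ2 leq_exp2l.
have /subsetPn[b Gb] : ~~ (G \subset 'C_G[c]).
  by apply/negP=> /subset_leq_card; rewrite oC oG leq_exp2l.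
rewrite inE Gb => /cent1P ncbc.
have genG := joing_cycles_cent1 c a b Z2c notZc Ga Gb notZ2a cac ncbc.
exists a, b; set d := [~ a, b].
have G'd : d \in G^`(1) by rewrite derg1 mem_commg.
have Z2d := subsetP der_ucn2 d G'd.
have notZd : d \notin 'Z(G).
  apply: contra der_not_center => Zd; rewrite -[X in X^`(1)]genG.
  rewrite der1_joing_cycles ?cycle_subG //.
  by rewrite genG; case/setIP: Zd.
(* Modulo ['Z(G)] the commutator of the two generators is central, so it generates the derived
   subgroup. *)
have sG'd : G^`(1) \subset 'Z(G) * <[d]>.
  have nZ := subsetP (gFnorm _ G : G \subset 'N('Z(G))).
  have Gd : d \in G by rewrite groupR.
  have genGZ : G / 'Z(G) = <[coset 'Z(G) a]> <*> <[coset 'Z(G) b]>.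
    by rewrite -[X in X / _]genG quotientY ?cycle_subG ?quotient_cycle ?nZ.
  have dE : coset 'Z(G) d = [~ coset 'Z(G) a, coset 'Z(G) b] by rewrite morphR ?nZ.
  rewrite -quotientSK ?(subset_trans (der_sub 1 G)) ?gFnorm //.
  rewrite quotient_der ?gFnorm // genGZ der1_joing_cycles.
    by rewrite -dE quotient_cycle ?nZ.
  have ZGZ := ucn_central 1 G; rewrite ucn1 in ZGZ.
  have : coset 'Z(G) d \in 'Z(G / 'Z(G)) by rewrite -ZGZ mem_quotient.
  by rewrite -genGZ -dE => /setIP[].
split=> //; split=> //.
apply/cent1P; have : a \in 'C_G[c] by rewrite inE Ga; apply/cent1P.
(* Since [c] is a central element times a power of [d], what centralises [d] centralises [c]; the
   orders agree. *)
suff -> : 'C_G[c] = 'C_G[d] by case/setIP.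
apply/esym/eqP; rewrite eqEcard oC (card_cent1_ucn2 d) // leqnn andbT.
apply/subsetP=> u /setIP[Gu /cent1P cud]; rewrite inE Gu; apply/cent1P.
have /mulsgP[z _ Zz /cycleP[i ->] ->] := subsetP sG'd c G'c.
by apply: commuteM; [apply: Z_comm | apply: commuteX].
Qed.


(** Conjugation by [b] multiplies both [a ^+ p] and a suitable power of [d] by [d ^+ p]. They thus
    agree modulo ['Z(G) = <[d ^+ p]>], which puts [a ^+ p] in [<[d]>]. *)
Lemma exists_cycle_pcube : exists a b, let d := [~ a, b] in
  [/\ a \in G, b \in G, a \notin 'Z_2(G), d \notin 'Z(G) & commute a d] /\
  [/\ #[a] = (p ^ 3)%N, <[a ^+ p]> = <[d]>, 'Z(G) \subset <[a ^+ (p ^ 2)]>,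
      G^`(1) \subset <[d]> & [~ a, b ^+ p] != 1].
Proof.
have [a [b [[Ga Gb genG] [notZ2a cad notZd sG'd]]]] := exists_generators.
exists a, b => /=; set d := [~ a, b] in cad notZd sG'd *.
have Gd : d \in G by rewrite groupR.
have Z2d : d \in 'Z_2(G) by rewrite (subsetP der_ucn2) // derg1 mem_commg.
set z := [~ d, b]; have Zz : z \in 'Z(G) := comm_Z2 d b Z2d Gb.
have centG u : u \in G -> commute a u -> commute b u -> u \in 'Z(G).
  move=> Gu cau cbu; apply/setIP; split=> //; rewrite -genG centY !cent_cycle.
  by apply/setIP; split; apply/cent1P/commute_sym.
have Zdp : d ^+ p \in 'Z(G).
  apply: centG; rewrite ?groupX //; first exact: commuteX.
  apply/esym/commgP; rewrite commXg ?Z_exp //.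
  exact: Z_comm.
have abp : a ^ (b ^+ p) = a * d ^+ p.
  rewrite (conjX_class3 _ a b p cad) -/d -/z; try exact: Z_comm.
  (* As [p] is odd it divides ['C(p, 2)], so the power of [z] vanishes. *)
  by rewrite bin2odd // expgM -/z (Z_exp z) // expg1n mulg1.
have apb : (a ^+ p) ^ b = a ^+ p * d ^+ p.
  by rewrite conjXg conjg_mulR expgMn.
have ab_comm : [~ a, b ^+ p] = d ^+ p by rewrite commgEl abp mulKg.
have dp_neq1 : d ^+ p != 1.
  (* Otherwise a ^+ p and b ^+ p are central, so both G^`(1) and G / G^`(1) have
     order at most p ^ 2. *)
  apply/eqP=> dp1.
  have Zap : a ^+ p \in 'Z(G).
    apply: centG; rewrite ?groupX //; first exact: commuteX.
    by apply/esym/commgP/conjg_fixP; rewrite apb dp1 mulg1.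
  have Zbp : b ^+ p \in 'Z(G).
    apply: centG; rewrite ?groupX //; last exact: commuteX.
    by apply/commgP; rewrite ab_comm dp1.
  have oG' : #|G^`(1)| <= p ^ 2.
    apply: leq_trans (subset_leq_card sG'd) _.
    apply: leq_trans (leq_card_mulG _ _ _) _; rewrite oZ leq_pmul2l //.
    by rewrite dvdn_leq // order_dvdn dp1.
  have nG'G := subsetP (gFnorm _ G : G \subset 'N(G^`(1))).
  have genGG' : G / G^`(1) = <[coset G^`(1) a]> <*> <[coset G^`(1) b]>.
    by rewrite -[X in X / _]genG quotientY ?cycle_subG ?quotient_cycle ?nG'G.
  have cGG' : <[coset G^`(1) b]> \subset 'C(<[coset G^`(1) a]>).
    apply: sub_abelian_cent2 (der_abelian 0 G) _ _;
      by rewrite cycle_subG mem_quotient.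
  have o_coset u : u \in G -> u ^+ p \in 'Z(G) -> #[coset G^`(1) u] <= p.
    move=> Gu Zup; rewrite dvdn_leq // order_dvdn -morphX ?nG'G //=.
    by rewrite coset_id // (subsetP sZG').
  have oGG' : #|G / G^`(1)| <= p * p.
    rewrite genGG' cent_joinEr //; apply: leq_trans (leq_card_mulG _ _ _) _.
    by rewrite leq_mul ?o_coset.
  have := leq_mul oG' oGG'; rewrite card_quotient ?gFnorm // Lagrange ?der_sub //.
  by rewrite oG mulnn -expnD leq_exp2l.
have Zdp_gen : 'Z(G) = <[d ^+ p]>.
  apply/esym/eqP; rewrite eqEcard cycle_subG Zdp oZ -orderE.
  by rewrite (nt_prime_order pr_p (Z_exp _ Zdp)) ?leqnn.
have z_neq1 : z != 1.
  apply: contra notZd => /commgP cdb; apply: centG => //; exact: commute_sym.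
have Zz_gen : 'Z(G) = <[z]>.
  apply/esym/eqP; rewrite eqEcard cycle_subG Zz oZ -orderE.
  by rewrite (nt_prime_order pr_p (Z_exp _ Zz)) ?leqnn.
have /cycleP[i dpE] : d ^+ p \in <[z]> by rewrite -Zz_gen.
have dib : (d ^+ i) ^ b = d ^+ i * d ^+ p.
  by rewrite conjXg conjg_mulR expgMn ?dpE //; apply: Z_comm.
have ap_d : a ^+ p \in <[d]>.
  have : a ^+ p * d ^- i \in 'Z(G).
    apply: centG; first by rewrite groupM ?groupV ?groupX.
      by apply: commuteM; [apply: commuteX | apply/commuteV/commuteX].
    apply/esym/commgP/conjg_fixP; rewrite conjMg conjVg apb dib invMg.
    by rewrite -mulgA mulKVg.
  rewrite Zdp_gen => /cycleP[j /(canRL (mulgKV _)) ->].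
  by rewrite groupM ?groupX ?cycle_id.
have dp2 : d ^+ (p ^ 2) = 1 by rewrite expgM Z_exp.
have od : #[d] = (p ^ 2)%N by apply: order_pfactor; rewrite ?expn1.
have /cycleP[k apE] := ap_d.
have Zap2 : a ^+ (p ^ 2) \in 'Z(G).
  by rewrite expgM apE -expgM mulnC expgM groupX.
(* If [p] divided [k], then [a ^+ p] would be central, and [apb] would give [d ^+ p = 1]. *)
have ap2_neq1 : a ^+ (p ^ 2) != 1.
  rewrite expgM apE -expgM -order_dvdn od dvdn_pmul2r //.
  apply: contra dp_neq1 => /dvdnP[m def_k].
  have Zap : a ^+ p \in 'Z(G) by rewrite apE def_k mulnC expgM groupX.
  have /commgP/conjg_fixP := esym (Z_comm _ b Zap Gb).
  by rewrite apb => /(canRL (mulKg _)); rewrite mulVg => ->.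
have oa : #[a] = (p ^ 3)%N.
  by apply: order_pfactor; rewrite // expnS expgM apE -expgM mulnC expgM dp2 expg1n.
have gen_ap : <[a ^+ p]> = <[d]>.
  apply/eqP; rewrite eqEcard cycle_subG ap_d -!orderE od orderXdiv oa.
    by rewrite (expnSr p 2) mulnK ?leqnn.
  by rewrite dvdn_exp.
split; split=> //; last by rewrite ab_comm.
  suff -> : 'Z(G) = <[a ^+ (p ^ 2)]> by [].
  apply/esym/eqP; rewrite eqEcard cycle_subG Zap2 oZ -orderE.
  by rewrite (nt_prime_order pr_p (Z_exp _ Zap2)) ?leqnn.
by apply: subset_trans sG'd _; rewrite mul_subG // Zdp_gen cycleX.
Qed.


Lemma exists_Phi8_relations : exists x y : gT,
  [/\ <[x]> <*> <[y]> = G, x ^+ (p ^ 3) = 1, y ^+ (p ^ 2) = 1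
    & x ^ y = x ^+ (1 + p)].
Proof.
have [a [c [[Ga Gc notZ2a notZd cad] [oa gen_d sZap2 sG'd acp_neq1]]]] :=
  exists_cycle_pcube.
set d := [~ a, c] in notZd cad gen_d sG'd.
have Z2d : d \in 'Z_2(G) by rewrite (subsetP der_ucn2) // derg1 mem_commg.
have ap3 : a ^+ (p ^ 3) = 1 by rewrite -oa expg_order.
have Z2cp : c ^+ p \in 'Z_2(G).
  have := subsetP (joing_subr G^`(1) 'Mho^1(G));
  rewrite -(Phi_joing pG) Phi_ucn2; apply.
  by have := Mho_p_elt 1 Gc (mem_p_elt pG Gc); rewrite expn1.
have oCa : #|'C_G[a]| <= p ^ 3.
  (* A centraliser of order at least [p ^ 4] is [G] or maximal, so it contains ['Phi(G) = 'Z_2(G)]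
     and in particular [c ^+ p]. *)
  have [k /= oC] := p_natP (pgroupS (subsetIl G 'C[a]) pG).
  rewrite oC leq_exp2l // leqNgt; apply: contra acp_neq1 => k_gt3.
  apply/commgP/cent1P; suff: 'Z_2(G) \subset 'C_G[a].
    by move/subsetP/(_ _ Z2cp); rewrite cent1C => /setIP[].
  have [-> | [M maxM sCM]] := maximal_exists (subsetIl G 'C[a]).
    exact: ucn_sub.
  suff -> : 'C_G[a] = M by rewrite -Phi_ucn2 Phi_sub_max.
  have := Lagrange (normal_sub (p_maximal_normal pG maxM)).
  rewrite (p_maximal_index pG maxM) oG (expnSr p 4) => /eqP.
  rewrite eqn_pmul2r // => /eqP oM.
  by apply/eqP; rewrite eqEcard sCM oM oC leq_exp2l.
have aG : a ^: G = a *: <[d]>.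
  apply/eqP; rewrite eqEcard; apply/andP; split.
    apply/subsetP=> _ /imsetP[x Gx ->]; rewrite mem_lcoset -commgEl.
    by rewrite (subsetP sG'd) // derg1 mem_commg.
  have := Lagrange (subsetIl G 'C[a]); rewrite index_cent1 oG => oaG.
  rewrite card_lcoset -gen_d -orderE orderXdiv oa ?dvdn_exp // (expnSr p 2) mulnK //.
  rewrite -(leq_pmul2l (cardG_gt0 'C_G[a])) oaG (expnD p 3 2).
  by rewrite leq_mul2r oCa orbT.
have /imsetP[b Gb ab] : a ^+ (1 + p) \in a ^: G.
  by rewrite aG mem_lcoset expgS mulKg -gen_d cycle_id.
(* Such a [y] cannot commute with [d]: [a ^+ p] is a power of [d], and [[~ a ^+ p, y] = a ^+ (p ^
   2)] is nontrivial. *)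
have gen_b y : y \in G -> a ^ y = a ^+ (1 + p) -> <[a]> <*> <[y]> = G.
  move=> Gy ay; apply: (joing_cycles_cent1 d) => // cyd.
  have /cycleP[k apE] : a ^+ p \in <[d]> by rewrite -gen_d cycle_id.
  have /conjg_fixP : [~ a ^+ p, y] == 1.
    by apply/commgP/commute_sym; rewrite apE; apply: commuteX.
  rewrite conjXg ay -expgM mulnDl mul1n expgD => /(canRL (mulKg _)).
  rewrite mulVg => /eqP; rewrite -order_dvdn oa mulnn dvdn_Pexp2l //.
have Zbp2 : b ^+ (p ^ 2) \in 'Z(G).
  apply/setIP; split; first exact: groupX.
  rewrite -(gen_b b Gb (esym ab)) centY !cent_cycle; apply/setIP; split;
    apply/cent1P.
    apply/commute_sym/commgP/conjg_fixP.
    have ->: a ^ (b ^+ (p ^ 2)) = a ^+ ((1 + p) ^ (p ^ 2)).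
      elim: (p ^ 2)%N => [|n IHn]; first by rewrite conjg1.
      by rewrite expgSr conjgM IHn conjXg -ab -expgM expnS.
    have [v ->] := expn_succ_prime p 2 odd_p.
    by rewrite expgD expgM ap3 expg1n mulg1.
  exact/commute_sym/commuteX.
have /cycleP[k bp2] := subsetP sZap2 _ Zbp2.
(* By [expMg_conjX], the power [(b * h) ^+ (p ^ 2)] is [b ^+ (p ^ 2)] times [h] to a power congruent
   to [p ^ 2] modulo [p ^ 3]; this choice of [h] cancels it. *)
pose h := a ^- k; exists a, (b * h).
have ay : a ^ (b * h) = a ^+ (1 + p).
  rewrite conjgM -ab; apply/conjg_fixP/commgP/commuteV/commuteX.
  exact/commute_sym/commuteX.
split=> //; first by rewrite gen_b // groupM // groupV groupX.
rewrite (expMg_conjX _ _ _ (1 + p)); last by rewrite conjVg conjXg -ab expgAC expgVn.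
have [v ->] := sum_expn_succ_prime p 2 odd_p.
rewrite bp2 expgVn -!expgM.
have -> : (k * (p ^ 2 * (1 + p * v)) = p ^ 2 * k + p ^ 3 * (k * v))%N.
  by rewrite !mulnDr muln1 [X in X + _]mulnC (expnSr p 2) -!mulnA !(mulnCA k).
by rewrite expgD [a ^+ (p ^ 3 * _)]expgM ap3 expg1n mulg1 mulgV.
Qed.

End Forward.

Theorem theorem4p1 (gT : finGroupType) (G : {group gT}) (p : nat) :
  prime p -> odd p -> #|G| = (p ^ 5)%N -> nil_class G = 3 ->
  (Autz G = 'Z(Inn G)
   <-> G \isog Grp (a1 : a2 : b :
         [~ a1, a2] = b = a1 ^+ p,
         b ^+ (p ^ 2)%N = a2 ^+ (p ^ 2)%N = 1)).
Proof.
move=> pr_p odd_p oG clG; split=> [/Autz_sub_InnP sAI | isoG].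
  apply: isoGrp_Phi8 => //.
  exact: (exists_Phi8_relations _ G p pr_p odd_p oG clG sAI).
have /homGrp_Phi8P[x [y [genG xp yp xy]]] := isoGrp_hom isoG.
exact: (Phi8_Autz _ G p x y).
Qed.
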